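(* Consider the hybrid system $\mathcal{H}=(C,f,D,G)$ described in the context, on a directed, weight-balanced, strongly connected weighted graph with $N$ agents. Suppose each agent $i\in\{1,\dots,N\}$ implements the distributed dynamic event-triggered coordination algorithm described in the context, with design parameter $\sigma_i\in(0,1)$. Then the inter-event times of agent $i$ are lower-bounded by $$T_i := \frac{\sigma_i}{d_i} > 0,$$ that is, $t^i_{\ell+1}-t^i_\ell \ge T_i$ for all $i\in\{1,\dots,N\}$ and all $\ell\in\mathbb{Z}_{\ge 0}$.
   Context: Graph. $\mathcal{G}$ is a directed, weight-balanced, strongly connected graph on vertices $\{1,\dots,N\}$, $N\ge 2$, with edge set $\mathcal{E}$ and weights $w_{ij}>0$ for $(i,j)\in\mathcal{E}$. If $(i,j)\in\mathcal{E}$, $j$ is an out-neighbor of $i$; $\mathcal{N}_i^{\text{out}}$ is the set of out-neighbors of $i$. The degree is $d_i=\sum_{j\in\mathcal{N}_i^{\text{out}}}w_{ij}$; weight-balanced means this out-degree equals the in-degree $\sum_{j:(j,i)\in\mathcal{E}}w_{ji}$ for every $i$. The Laplacian is $L=\mathrm{diag}(d_1,\dots,d_N)-A$, with $A$ the weighted adjacency matrix (entries $w_{ij}$). State. Agent $i$ has a physical state $x_i\in\mathbb{R}$, a last broadcast state $\hat{x}_i\in\mathbb{R}$, and a clock-like variable $\chi_i\in\mathbb{R}$; $q_i=(x_i,\hat{x}_i,\chi_i)$ and $q=(q_1,\dots,q_N)\in\mathbb{R}^{3N}$. Define $$e_i=x_i-\hat{x}_i,\qquad \hat{z}_i=(L\hat{x})_i=\sum_{j\in\mathcal{N}_i^{\text{out}}}w_{ij}(\hat{x}_i-\hat{x}_j),\qquad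 \hat{\phi}_i=\sum_{j\in\mathcal{N}_i^{\text{out}}}w_{ij}(\hat{x}_i-\hat{x}_j)^2 .$$ Hybrid system $\mathcal{H}=(C,f,D,G)$. Flow set $C=\{q:\chi_i\ge 0\ \forall i\}$, with flow $$\dot{x}_i=-\hat{z}_i,\qquad \dot{\hat{x}}_i=0,\qquad \dot{\chi}_i=\gamma_i:=\sigma_i\hat{\phi}_i+2e_i\hat{z}_i .$$ Jump set $D=\bigcup_i D_i$, $D_i=\{q:\chi_i\le 0\}$. An event (broadcast) of agent $i$ is the jump $q\mapsto g_i(q)$ which replaces $\hat{x}_i$ by $x_i$ and leaves every other component of $q$ unchanged; $G(q)$ is the set of all $g_i(q)$ with $q\in D_i$. Algorithm. At $t=0$ each agent sets $\hat{x}_i(0)=x_i(0)$ (arbitrary) and $\chi_i(0)=0$; set $t_0^i=0$. Agent $i$ triggers an event exactly when $\chi_i=0$ and $e_i\neq 0$, i.e. its event times are $$t^i_{\ell+1}=\inf\{t\ge t^i_\ell:\ \chi_i(t)=0\ \text{and}\ e_i(t)\ne 0\}$$ (values after the update at $t^i_\ell$; the infimum of the empty set is $+\infty$). At an event agent $i$ sets $\hat{x}_i=x_i$ and broadcasts it to its in-neighbors; otherwise the variables evolve by the flow above. The control input of agent $i$ is always $u_i=-\hat{z}_i$. *)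

(* Defs.v *)
From HB Require Import structures.
From mathcomp Require Import all_boot all_order all_algebra.
From mathcomp Require Import all_classical all_reals all_analysis.

Set Implicit Arguments.
Unset Strict Implicit.
Unset Printing Implicit Defensive.

Import Order.TTheory GRing.Theory Num.Theory.
Import numFieldNormedType.Exports.

Local Open Scope classical_set_scope.
Local Open Scope ring_scope.

(** * Weighted directed graphs *)

(* [weight] is also the weighted adjacency matrix, hence the convention that
   it vanishes off the edges. *)
Record digraph (R : realType) (N : nat) := Digraph {
  edge : rel 'I_N;
  weight : 'M[R]_N;
  weight_gt0 : forall i j, edge i j -> 0 < weight i j;
  weight_eq0 : forall i j, ~~ edge i j -> weight i j = 0
}.

Section Graph.
Variables (R : realType) (N : nat) (g : digraph R N).

Definition degree (i : 'I_N) : R := \sum_(j | edge g i j) weight g i j.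

Definition in_degree (i : 'I_N) : R := \sum_(j | edge g j i) weight g j i.

Definition weight_balanced : Prop := forall i, degree i = in_degree i.

Definition strongly_connected : Prop := forall i j, connect (edge g) i j.

Definition laplacian : 'M[R]_N := diag_mx (\row_i degree i) - weight g.

End Graph.

(** * Hybrid systems and their solutions, after Goebel, Sanfelice and Teel *)

Record hybrid_system (R : realType) (m n : nat) := HybridSystem {
  flow_set : set 'M[R]_(m, n);
  flow_map : 'M[R]_(m, n) -> 'M[R]_(m, n);
  jump_set : set 'M[R]_(m, n);
  jump_map : 'M[R]_(m, n) -> set 'M[R]_(m, n)
}.

Section Hybrid.
Variable R : realType.

(* The union of the [s j, s (j+1)] x {j} for j < J. *)
Definition compact_hybrid_time_domain (E : set (R * nat)) : Prop :=
  exists (J : nat) (s : nat -> R),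
    [/\ s 0%N = 0,
        forall j, (j < J)%N -> s j <= s j.+1 &
        E = [set p | (p.2 < J)%N /\ s p.2 <= p.1 <= s p.2.+1]].

Definition hybrid_time_domain (E : set (R * nat)) : Prop :=
  E !=set0 /\
  forall T J, E (T, J) ->
    compact_hybrid_time_domain
      (E `&` [set p | 0 <= p.1 <= T /\ (p.2 <= J)%N]).

(* An arc is a function [q t j] of which only the values at (t, j) in its
   domain E matter.  Solutions are classical along flows; as the flow map
   considered below is continuous, requiring only local absolute continuity
   and the differential equation almost everywhere gives the same arcs. *)
Definition hybrid_solution (m n : nat) (H : hybrid_system R m n)
    (E : set (R * nat)) (q : R -> nat -> 'M[R]_(m, n)) : Prop :=
  [/\ hybrid_time_domain E,
      (closure (flow_set H) `|` jump_set H) (q 0 0%N),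
      forall j a b,
        {within [set t | E (t, j)], continuous (fun t : R => q t j a b)},
      forall j t, interior [set t' | E (t', j)] t ->
        flow_set H (q t j) /\
        forall a b, is_derive (t : R) (1 : R)
          (fun t' : R => q t' j a b) (flow_map H (q t j) a b) &
      forall t j, E (t, j) -> E (t, j.+1) ->
        jump_set H (q t j) /\ jump_map H (q t j) (q t j.+1)].

End Hybrid.

(** * Event-triggered consensus *)

Section Consensus.
Variables (R : realType) (N : nat) (g : digraph R N) (sigma : 'I_N -> R).

(* Row i of the state is q_i = (x_i, xhat_i, chi_i). *)
Implicit Types (q : 'M[R]_(N, 3)) (i : 'I_N).

Definition phys q i : R := q i 0.
Definition bcast q i : R := q i 1.
Definition clock q i : R := q i 2.

Definition err q i : R := phys q i - bcast q i.

Definition zhat q i : R := (laplacian g *m \col_j bcast q j) i 0.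

Lemma zhatE q i :
  zhat q i = \sum_(j | edge g i j) weight g i j * (bcast q i - bcast q j).
Proof.
rewrite /zhat /laplacian mulmxBl mul_diag_mx !mxE /degree mulr_suml.
rewrite [X in _ - X](bigID (edge g i)) /=.
rewrite [X in _ - (_ + X)]big1 ?addr0; last first.
  by move=> j /weight_eq0 ->; rewrite mul0r.
by rewrite -sumrB; apply: eq_bigr => j _; rewrite mxE mulrBr.
Qed.

Definition phihat q i : R :=
  \sum_(j | edge g i j) weight g i j * (bcast q i - bcast q j) ^+ 2.

Definition gamma q i : R := sigma i * phihat q i + 2 * err q i * zhat q i.

Definition broadcast i q : 'M[R]_(N, 3) :=
  \matrix_(a, b) if (a == i) && (b == 1) then phys q i else q a b.

Definition agent_jump_set i : set 'M[R]_(N, 3) := [set q | clock q i <= 0].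

Definition consensus_system : hybrid_system R N 3 :=
  {| flow_set := [set q | forall i, 0 <= clock q i];
     flow_map := fun q => \matrix_(i, b) [:: - zhat q i; 0; gamma q i]`_b;
     jump_set := [set q | exists i, agent_jump_set i q];
     jump_map := fun q =>
       [set q' | exists2 i, agent_jump_set i q & q' = broadcast i q] |}.

Definition triggered i q : Prop := clock q i = 0 /\ err q i <> 0.

Section Trajectory.
Variables (E : set (R * nat)) (q : R -> nat -> 'M[R]_(N, 3)).

(* Agent i broadcasts in the jump from (t, j) to (t, j+1). *)
Definition event_at i (t : R) (j : nat) : Prop :=
  [/\ E (t, j), E (t, j.+1) & q t j.+1 = broadcast i (q t j)].

(* Events of several agents at the same instant are consecutive jumps in an
   arbitrary order; hence the event required by the last clause need not be
   the very next jump. *)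
Definition implements_algorithm : Prop :=
  [/\ hybrid_solution consensus_system E q,
      forall i, bcast (q 0 0%N) i = phys (q 0 0%N) i /\ clock (q 0 0%N) i = 0,
      forall t j, E (t, j) -> E (t, j.+1) ->
        exists2 i, triggered i (q t j) & q t j.+1 = broadcast i (q t j) &
      forall i t j, E (t, j) -> triggered i (q t j) ->
        exists2 k, (j <= k)%N & event_at i t k].

(* At hybrid time (t, j), xhat_i has already been reset to x_i at instant t,
   by the initialization if t = 0 and otherwise by an event. *)
Definition updated i (t : R) (j : nat) : Prop :=
  t = 0 \/ exists2 k, (k < j)%N & event_at i t k.

(* An instant t may carry several values q t j.  At t = t_l only those
   after the update of agent i are considered. *)
Fixpoint event_time i (l : nat) : \bar R :=
  if l is l'.+1 then
    ereal_inf [set t%:E | t in [set t : R |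
      (event_time i l' <= t%:E)%E /\
      exists j, [/\ E (t, j),
                    event_time i l' = t%:E -> updated i t j &
                    triggered i (q t j)]]]
  else 0%E.

End Trajectory.

End Consensus.

(* Main.v *)
Require Import Defs.
From mathcomp Require Import all_boot all_order all_algebra.
From mathcomp Require Import all_classical all_reals all_analysis.
From mathcomp Require Import ring lra.

Set Implicit Arguments.
Unset Strict Implicit.
Unset Printing Implicit Defensive.

Import Order.TTheory GRing.Theory Num.Theory.
Import numFieldNormedType.Exports.

Local Open Scope classical_set_scope.
Local Open Scope ring_scope.

(** Write T_i = sigma_i / d_i, and consider an instant s at which e_i = 0 and
    chi_i = 0: the initial one, or one just after an event of agent i.  Along
    flows e_i' = - zhat_i and (chi_i + e_i^2)' = sigma_i phihat_i, and
    Cauchy-Schwarz gives zhat_i^2 <= d_i phihat_i.  Hence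
      e_i(t)^2 <= (t - s) * (integral of zhat_i^2 over [s, t])
               <= (t - s) / T_i * (chi_i(t) + e_i(t)^2),
    and chi_i(t) = 0 with e_i(t) <> 0 forces t - s >= T_i.

    The formal proof replaces the integrals by a family of barriers that are
    affine in e_i, one for each real c,
      chi_i + e_i^2 - 2 c e_i + c^2 (t - s) / T_i.
    Its derivative is a sum of squares ([phihat_zhat_ge0]), so it does not
    decrease along flows ([barrier_flow]); it is unaffected by the events of
    the other agents, and nonnegative after those of agent i
    ([barrier_ge0]).  Choosing c = e_i(t) at a trigger gives the bound
    ([dwell_time]).

    What remains is to pass to event times, which are infima.  If the instant
    t of a trigger is after the infimum t_l, there is an earlier trigger (for
    l = 0, the initial instant) in [t_l, t[, and the bound is applied between
    the two; if t = t_l, agent i has been reset at that very instant and the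
    bound rules the trigger out ([event_time_dwell]).

    Hybrid time must therefore be ordered: a point at a later instant must
    have undergone at least as many jumps.  This can fail in a hybrid time
    domain, since [0, 2] x {0} together with (1, 1) is one: its truncations
    at each of its points are all compact hybrid time domains.  It does hold
    at triggers, because a trigger is followed by a jump at the same instant
    ([event_order]). *)

(** * Hybrid time domains *)

Section HybridTimeDomain.
Variables (R : realType) (E : set (R * nat)).
Hypothesis hE : hybrid_time_domain E.

(** The truncation at (T, J) read as a partition of [0, T].  For negative T
    the truncation is empty and the definition does not constrain (T, J). *)
Lemma hybrid_time_partition (T : R) (J : nat) : E (T, J) -> 0 <= T ->
  exists s : nat -> R,
    [/\ s 0%N = 0,
        {homo s : a b / (a <= b <= J.+1)%N >-> a <= b},
        s J.+1 <= T &
        forall t j, (j <= J)%N -> 0 <= t <= T ->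
          E (t, j) <-> s j <= t <= s j.+1].
Proof.
move=> ETJ T0; case: hE => _ /(_ _ _ ETJ) -[J' [s [s0 smono Eset]]].
have JJ' : (J < J')%N.
  have : (E `&` [set p | 0 <= p.1 <= T /\ (p.2 <= J)%N]) (T, J).
    by split=> //=; rewrite T0 lexx.
  by rewrite Eset => -[].
exists s; split=> //.
- move=> a; elim=> [|b IHb]; first by rewrite leqn0 => /andP[/eqP->].
  move=> /andP[]; rewrite leq_eqVlt => /predU1P[->//|ab bJ].
  apply: (@le_trans _ _ (s b)); first by apply: IHb; rewrite -ltnS ab ltnW.
  by apply: smono; exact: leq_trans bJ JJ'.
- have : [set p : R * nat | (p.2 < J')%N /\ s p.2 <= p.1 <= s p.2.+1]
      (s J.+1, J) by split=> //=; rewrite lexx smono.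
  by rewrite -Eset => -[_ [/andP[]]].
move=> t j jJ tT; split=> [Etj|tj].
  have : (E `&` [set p | 0 <= p.1 <= T /\ (p.2 <= J)%N]) (t, j) by split.
  by rewrite Eset => -[].
have : [set p : R * nat | (p.2 < J')%N /\ s p.2 <= p.1 <= s p.2.+1] (t, j).
  by split=> //=; exact: leq_ltn_trans JJ'.
by rewrite -Eset => -[].
Qed.

(** The jump available at (T, k) excludes the branching described at the top:
    it makes interval k end at T, so that no interval of index above k starts
    before T, and (T', m) lies in the truncation at (T, k + 1). *)
Lemma event_order (T T' : R) (j k m : nat) :
  0 <= T' -> T' < T -> E (T', m) -> E (T, j) -> E (T, k) -> E (T, k.+1) ->
  (j <= k)%N -> (m <= j)%N.
Proof.
move=> T'0 ltT ET'm ETj ETk ETk1 jk.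
have T0 : 0 <= T by exact: le_trans T'0 (ltW ltT).
have T'T : 0 <= T' <= T by rewrite T'0 ltW.
have TT : 0 <= T <= T by rewrite T0 lexx.
have [s [s0 smono sT sE]] := hybrid_time_partition ETk1 T0.
have mk : (m <= k)%N.
  rewrite leqNgt; apply/negP => km.
  (* Interval k + 1 would start at u (k + 1) <= T' < T, whereas interval k
     is still running at T. *)
  have [u [u0 umono uT uE]] := hybrid_time_partition ET'm T'0.
  have k1m : (k.+1 <= m)%N by [].
  have uk0 : 0 <= u k.+1 by rewrite -u0; apply: umono; rewrite leq0n ltnW.
  have ukT' : u k.+1 <= T'.
    by apply: le_trans uT; apply: umono; rewrite leqnn andbT ltnW.
  have : E (u k.+1, k.+1).
    apply/uE; rewrite ?uk0 ?ukT' ?lexx //=.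
    by apply: umono; rewrite leqnSn /= ltnS.
  rewrite sE ?leqnn ?uk0 ?(le_trans ukT' (ltW ltT))// => /andP[su _].
  move: ETk; rewrite sE // => /andP[_ Ts].
  have := le_trans Ts su; rewrite leNgt.
  by rewrite (le_lt_trans ukT' ltT).
rewrite leqNgt; apply/negP => jm.
move: ET'm; rewrite sE ?(leq_trans mk)// => /andP[sm _].
move: ETj; rewrite sE ?(leq_trans jk)// => /andP[_ sj].
have sjm : s j.+1 <= s m by apply: smono; rewrite jm /= (leq_trans mk)// ltnW.
have := le_trans sj (le_trans sjm sm).
by rewrite leNgt ltT.
Qed.

(** Here u is the instant of the jump from j to j + 1. *)
Lemma hybrid_time_pred (T : R) (j : nat) : E (T, j.+1) -> 0 <= T ->
  exists u, [/\ 0 <= u <= T, E (u, j), E (u, j.+1) &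
    forall t k, (k <= j)%N -> 0 <= t <= T -> E (t, k) -> t <= u].
Proof.
move=> ETj T0; have [s [s0 smono sT sE]] := hybrid_time_partition ETj T0.
have sle a b : (a <= b)%N -> (b <= j.+2)%N -> s a <= s b.
  by move=> ab bj; apply: smono; rewrite ab.
have s01 : 0 <= s j.+1 <= T.
  by rewrite -{1}s0 sle//= (le_trans _ sT) ?sle.
exists (s j.+1); split=> //.
- by apply/sE => //; rewrite lexx andbT sle.
- by apply/sE => //; rewrite lexx /= sle.
move=> t k kj tT; rewrite sE//; last exact: leq_trans kj _.
by move=> /andP[_ ts]; rewrite (le_trans ts)// sle.
Qed.

Lemma hybrid_time_slice (a b t : R) (j : nat) :
  0 <= a -> E (a, j) -> E (b, j) -> a <= t <= b -> E (t, j).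
Proof.
move=> a0 Ea Eb /andP[at_ tb].
have t0 := le_trans a0 at_.
have [s [s0 smono sT sE]] := hybrid_time_partition Eb (le_trans t0 tb).
have b0 := le_trans t0 tb.
have ab := le_trans at_ tb.
move: Ea Eb; rewrite !sE ?leqnn ?a0 ?t0 ?b0 ?lexx //.
by move=> /andP[sa _] /andP[_ bs]; rewrite (le_trans sa at_) (le_trans tb bs).
Qed.

End HybridTimeDomain.

(** * The barrier inequality *)

Section Flow.
Variable R : realType.

(** The last hypothesis is the sign of the derivative of
    chi + (x - y)^2 - 2 c (x - y) + k t. *)
Lemma barrier_nondecreasing (x y chi dx dchi : R -> R) (a b c k : R) : a <= b ->
  {within `[a, b], continuous x} -> {within `[a, b], continuous y} ->
  {within `[a, b], continuous chi} ->
  (forall t, t \in `]a, b[ -> is_derive t 1 x (dx t)) ->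
  (forall t, t \in `]a, b[ -> is_derive t 1 y 0) ->
  (forall t, t \in `]a, b[ -> is_derive t 1 chi (dchi t)) ->
  (forall t, t \in `]a, b[ ->
     0 <= dchi t + 2 * (x t - y t - c) * dx t + k) ->
  chi a + (x a - y a) ^+ 2 - 2 * c * (x a - y a) + k * a <=
  chi b + (x b - y b) ^+ 2 - 2 * c * (x b - y b) + k * b.
Proof.
move=> ab cx cy cchi Dx Dy Dchi ge0.
pose W : R -> R := chi + (x - y) * (x - y) - cst (2 * c) * (x - y) + cst k * id.
have DW t : t \in `]a, b[ ->
  is_derive t 1 W (dchi t + 2 * (x t - y t - c) * dx t + k).
  move=> tab; have := Dx t tab; have := Dy t tab; have := Dchi t tab.
  move=> ? ? ?; rewrite /W; apply: is_derive_eq.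
  by rewrite /GRing.scale /= /cst /= !fctE; ring.
have cst_cont (u : R) : {within `[a, b], continuous (cst u : R -> R)}.
  by apply: continuous_subspaceT => ?; exact: cvg_cst.
have id_cont : {within `[a, b], continuous (id : R -> R)}.
  by apply: continuous_subspaceT => ?; exact: cvg_id.
have cM (f g : R -> R) : {within `[a, b], continuous f} ->
    {within `[a, b], continuous g} -> {within `[a, b], continuous (f * g)}.
  by move=> cf cg t; apply: continuousM; [exact: cf|exact: cg].
have cxy := within_continuousB cx cy.
have cW : {within `[a, b], continuous W}.
  apply: within_continuousD; last exact: cM.
  apply: within_continuousB; last exact: cM.
  by apply: within_continuousD => //; exact: cM.
have le_W := @ger0_derive1_le_cc R W a b _ _ cW a b.
suff : W a <= W b by rewrite /W !fctE /= !expr2.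
apply: le_W; rewrite ?in_itv/= ?lexx ?ab//.
- by move=> t /DW [].
- by move=> t tab; have Dt := DW t tab; rewrite derive1E derive_val ge0.
Qed.

End Flow.

Section Graph.
Variables (R : realType) (N : nat) (g : digraph R N).

Lemma degree_gt0 (i : 'I_N) :
  (2 <= N)%N -> strongly_connected g -> 0 < degree g i.
Proof.
move=> hN hconn.
have [j ij] : exists j : 'I_N, j != i.
  have /card_gt0P[j] : (0 < #|predC1 i|)%N.
    by rewrite cardC1 card_ord -ltnS prednK// (leq_trans _ hN).
  by rewrite inE; exists j.
have /connectP[[/= _ ji|k p /= /andP[ik _] _]] := hconn i j.
  by rewrite ji eqxx in ij.
rewrite /degree (bigD1 k)//=; apply: ltr_pwDl; first exact: weight_gt0.
by apply: sumr_ge0 => l /andP[il _]; exact/ltW/weight_gt0.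
Qed.

Lemma degree_ge0 (i : 'I_N) : 0 <= degree g i.
Proof. by apply: sumr_ge0 => j ij; exact/ltW/weight_gt0. Qed.

(** The sum over the out-neighbors j of w_ij s (delta_j + c / s)^2, where
    delta_j = xhat_i - xhat_j.  This for all c amounts to the Cauchy-Schwarz
    inequality zhat_i^2 <= d_i phihat_i. *)
Lemma phihat_zhat_ge0 (s c : R) (q : 'M[R]_(N, 3)) (i : 'I_N) : 0 < s ->
  0 <= s * phihat g q i + 2 * c * zhat g q i + c ^+ 2 * (degree g i / s).
Proof.
move=> s0; rewrite zhatE /phihat /degree.
rewrite mulr_suml !mulr_sumr -!big_split /=.
apply: sumr_ge0 => j ij.
set d := _ - _; set w := weight _ _ _.
have -> : s * (w * d ^+ 2) + 2 * c * (w * d) + c ^+ 2 * (w / s) =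
          w * (s * (d + c / s) ^+ 2) by field; rewrite gt_eqF.
have w0 : 0 < w by exact: weight_gt0.
by apply: mulr_ge0; [exact: ltW|apply: mulr_ge0; [exact: ltW|exact: sqr_ge0]].
Qed.

Lemma phys_broadcast (i k : 'I_N) (q : 'M[R]_(N, 3)) :
  phys (broadcast i q) k = phys q k.
Proof. by rewrite /phys mxE andbF. Qed.

Lemma clock_broadcast (i k : 'I_N) (q : 'M[R]_(N, 3)) :
  clock (broadcast i q) k = clock q k.
Proof. by rewrite /clock mxE andbF. Qed.

Lemma err_broadcast (i k : 'I_N) (q : 'M[R]_(N, 3)) :
  err (broadcast i q) k = if k == i then 0 else err q k.
Proof.
rewrite /err phys_broadcast /bcast mxE eqxx andbT.
by case: eqVneq => // ->; rewrite subrr.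
Qed.

(** The sole jump that resets a nonzero error of agent k is a broadcast of
    k. *)
Lemma broadcast_inj (i k : 'I_N) (q : 'M[R]_(N, 3)) :
  err q k <> 0 -> broadcast i q = broadcast k q -> i = k.
Proof.
move=> ek /(congr1 (fun q' => err q' k)); rewrite !err_broadcast eqxx.
by case: eqVneq.
Qed.

End Graph.

(** * Dwell times of the algorithm *)

Section Algorithm.
Variables (R : realType) (N : nat) (g : digraph R N) (sigma : 'I_N -> R).
Variables (E : set (R * nat)) (q : R -> nat -> 'M[R]_(N, 3)).
Hypothesis hq : implements_algorithm g sigma E q.
Variable i : 'I_N.
Hypothesis sigma_gt0 : 0 < sigma i.

Let hE : hybrid_time_domain E. Proof. by have [[]] := hq. Qed.

(** The nonnegativity of all these, as c varies, encodes the quadratic bound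
    e_i^2 <= (t - s) d_i / sigma_i * (chi_i + e_i^2). *)
Definition barrier (c s t : R) (j : nat) : R :=
  clock (q t j) i + err (q t j) i ^+ 2 - 2 * c * err (q t j) i
    + c ^+ 2 * (degree g i / sigma i) * (t - s).

Lemma barrier_flow (c s a b : R) (j : nat) :
  0 <= a -> a <= b -> E (a, j) -> E (b, j) ->
  barrier c s a j <= barrier c s b j.
Proof.
move=> a0 ab Ea Eb.
have [[_ _ cont flow _] _ _ _] := hq.
have sub : `[a, b] `<=` [set t | E (t, j)].
  by move=> t /=; rewrite in_itv/=; exact: hybrid_time_slice.
have cont_ab p : {within `[a, b], continuous (fun t => q t j i p)}.
  exact: continuous_subspaceW sub (cont j i p).
have der t p : t \in `]a, b[ ->
    is_derive t 1 (fun t' => q t' j i p)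
      (flow_map (consensus_system g sigma) (q t j) i p).
  move=> tab; have /flow[_] : interior [set t | E (t, j)] t.
    by apply: (interiorS sub); rewrite interior_itv_bnd.
  exact.
have Dx t : t \in `]a, b[ ->
    is_derive t 1 (fun t' => q t' j i 0) (- zhat g (q t j) i).
  by move=> /(der _ 0); rewrite /= mxE.
have Dy t : t \in `]a, b[ -> is_derive t 1 (fun t' => q t' j i 1) 0.
  by move=> /(der _ 1); rewrite /= mxE.
have Dchi t : t \in `]a, b[ ->
    is_derive t 1 (fun t' => q t' j i 2) (gamma g sigma (q t j) i).
  by move=> /(der _ 2); rewrite /= mxE.
have := barrier_nondecreasing (c := c) (k := c ^+ 2 * (degree g i / sigma i))
  ab (cont_ab 0) (cont_ab 1) (cont_ab 2) Dx Dy Dchi.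
rewrite /barrier !(mulrBr _ _ s) !addrA lerD2r; apply=> t _.
have := phihat_zhat_ge0 g c (q t j) i sigma_gt0.
by congr (0 <= _); rewrite /gamma /err /phys /bcast; ring.
Qed.

(** Events of agent i between s and t may occur: after one of them
    chi_i = e_i = 0, and only the last, nonnegative, term of the barrier is
    left. *)
Lemma barrier_ge0 (c s t : R) (k j : nat) :
  0 <= s -> E (s, k) -> clock (q s k) i = 0 -> err (q s k) i = 0 ->
  (k <= j)%N -> s <= t -> E (t, j) -> 0 <= barrier c s t j.
Proof.
move=> s0 Esk chi0 e0.
have start : 0 <= barrier c s s k.
  by rewrite /barrier chi0 e0; lra.
have [_ _ jump _] := hq.
elim: j t => [|j IHj] t.
  rewrite leqn0 => /eqP kj st Et; rewrite kj in Esk start.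
  exact: le_trans start (barrier_flow c s s0 st Esk Et).
rewrite leq_eqVlt => /predU1P[kj|kj] st Et.
  rewrite -kj in Et *.
  exact: le_trans start (barrier_flow c s s0 st Esk Et).
have t0 := le_trans s0 st.
have [u [/andP[u0 ut] Euj Euj1 u_last]] := hybrid_time_pred hE Et t0.
have su : s <= u by apply: u_last Esk; rewrite ?s0.
apply: le_trans (barrier_flow c s u0 ut Euj1 Et).
have := IHj u kj su Euj.
have [m [clk0 _] qm] := jump u j Euj Euj1.
rewrite /barrier qm clock_broadcast err_broadcast.
have [im _|//] := eqVneq i m; rewrite -im in clk0.
rewrite clk0 expr0n /= mulr0 add0r subr0 add0r.
have k0 : 0 <= degree g i / sigma i by rewrite divr_ge0 ?degree_ge0// ltW.
by apply: mulr_ge0; [exact: mulr_ge0 (sqr_ge0 c) k0|rewrite subr_ge0].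
Qed.

(** Taking c = e_i(t) turns the barrier into
    e_i^2 ((t - s) d_i / sigma_i - 1). *)
Lemma dwell_time (s t : R) (k j : nat) :
  0 <= s -> E (s, k) -> clock (q s k) i = 0 -> err (q s k) i = 0 ->
  (k <= j)%N -> s <= t -> E (t, j) -> triggered i (q t j) ->
  s + sigma i / degree g i <= t.
Proof.
move=> s0 Es chi0 e0 kj st Et [clk0 /eqP et0].
have := barrier_ge0 (err (q t j) i) s0 Es chi0 e0 kj st Et.
rewrite /barrier clk0; set e := err _ _.
have e2 : 0 < e ^+ 2 by rewrite exprn_even_gt0.
have -> : 0 + e ^+ 2 - 2 * e * e + e ^+ 2 * (degree g i / sigma i) * (t - s) =
    e ^+ 2 * (degree g i * (t - s) / sigma i - 1) by ring.
rewrite pmulr_rge0// subr_ge0 ler_pdivlMr// mul1r -lerBrDl => le_d.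
have d0 : 0 < degree g i.
  rewrite lt_neqAle degree_ge0 andbT eq_sym; apply/eqP => d0.
  by move: le_d; rewrite d0 mul0r leNgt sigma_gt0.
by rewrite ler_pdivrMr// mulrC.
Qed.

(** By definition an event is a jump that has the effect of a broadcast of i;
    that chi_i = 0 then holds needs the jump to have been triggered by i
    itself. *)
Lemma reset_at_event (t : R) (k : nat) : event_at E q i t k ->
  clock (q t k.+1) i = 0 /\ err (q t k.+1) i = 0.
Proof.
move=> [Etk Etk1 qi]; have [_ _ jump _] := hq.
have [m [clk0 em] qm] := jump t k Etk Etk1.
have im : i = m by apply: broadcast_inj em _; rewrite -qi -qm.
by rewrite qi clock_broadcast err_broadcast eqxx im.
Qed.

Lemma dwell_time_event (s t : R) (k j : nat) :
  0 <= s -> event_at E q i s k -> s <= t -> E (t, j) -> triggered i (q t j) ->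
  (k < j)%N || (s < t) -> s + sigma i / degree g i <= t.
Proof.
move=> s0 ek st Et trig order.
have [chi0 e0] := reset_at_event ek.
have [_ Esk1 _] := ek.
apply: (dwell_time s0 Esk1 chi0 e0 _ st Et trig).
case/orP: order => // lt_st.
have [_ _ _ event] := hq.
have [m jm [Etm Etm1 _]] := event i t j Et trig.
exact: (event_order hE s0 lt_st Esk1 Et Etm Etm1 jm).
Qed.

Lemma dwell_time_start (t : R) (j : nat) :
  0 <= t -> E (t, j) -> triggered i (q t j) -> sigma i / degree g i <= t.
Proof.
move=> t0 Et trig; rewrite -[leLHS]add0r.
have [s [s0 smono sT sE]] := hybrid_time_partition hE Et t0.
have E00 : E (0, 0%N).
  apply/sE => //; first by rewrite lexx.
  by rewrite {1}s0 lexx -[leLHS]s0 smono.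
have [_ /(_ i)[bcast0 clk0] _ _] := hq.
apply: (dwell_time (lexx 0) E00 clk0 _ (leq0n j) t0 Et trig).
by rewrite /err bcast0 subrr.
Qed.

Lemma event_time_ge0 (l : nat) : (0 <= event_time E q i l)%E.
Proof.
elim: l => [|l IHl] //=.
by apply: le_ereal_inf_tmp => _ [t [lt _] <-]; exact: le_trans lt.
Qed.

Lemma event_time_dwell (l : nat) : 0 < sigma i / degree g i ->
  (event_time E q i l + (sigma i / degree g i)%:E
     <= event_time E q i l.+1)%E.
Proof.
move=> T0; apply: le_ereal_inf_tmp => _ [t [lt [j [Et upd trig]]] <-].
have t0 : 0 <= t by rewrite -lee_fin; exact: le_trans (event_time_ge0 l) lt.
have [eq_t|] := eqVneq (event_time E q i l) t%:E.
  exfalso; have [t_eq0|[k kj ek]] := upd eq_t.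
    have := dwell_time_start t0 Et trig.
    by rewrite t_eq0 leNgt T0.
  have kj' : (k < j)%N || (t < t) by rewrite kj.
  have := dwell_time_event t0 ek (lexx t) Et trig kj'.
  by rewrite gerDl leNgt T0.
move=> neq_t; have {neq_t}lt_t : (event_time E q i l < t%:E)%E.
  by rewrite lt_neqAle neq_t.
(* An earlier reset s of agent i; for l + 1 the infimum t_l need not be
   attained a priori, hence the inequality. *)
have [s [s0 le_s sT]] : exists s : R,
    [/\ 0 <= s, (event_time E q i l <= s%:E)%E & s + sigma i / degree g i <= t].
  case: l {lt upd} lt_t => [_|l lt_t].
    by exists 0; split=> //; rewrite add0r; exact: dwell_time_start Et trig.
  have [_ [s [ls [m [Esm upd_s trig_s]]] <-]] := ereal_inf_lt lt_t.
  rewrite lte_fin => lt_st.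
  have s0 : 0 <= s by rewrite -lee_fin; exact: le_trans (event_time_ge0 l) ls.
  exists s; split=> //.
    by apply: ereal_inf_lbound; exists s => //; split=> //; exists m.
  have [_ _ _ event] := hq.
  have [k _ ek] := event i s m Esm trig_s.
  by apply: dwell_time_event s0 ek (ltW lt_st) Et trig _; rewrite lt_st orbT.
apply: le_trans (_ : (s%:E + (sigma i / degree g i)%:E <= _)%E).
  exact: leeD2r.
by rewrite -EFinD lee_fin.
Qed.
End Algorithm.

Theorem theoremV1 (R : realType) (N : nat) (hN : (2 <= N)%N)
  (g : digraph R N) (hbal : weight_balanced g) (hconn : strongly_connected g)
  (sigma : 'I_N -> R) (hsigma : forall i, 0 < sigma i < 1)
  (E : set (R * nat)) (q : R -> nat -> 'M[R]_(N, 3))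
  (hq : implements_algorithm g sigma E q) :
  forall i : 'I_N,
    0 < sigma i / degree g i /\
    forall l : nat,
      (event_time E q i l + (sigma i / degree g i)%:E
         <= event_time E q i l.+1)%E.
Proof.
move=> i; have /andP[s0 _] := hsigma i.
have T0 : 0 < sigma i / degree g i by rewrite divr_gt0// degree_gt0.
by split=> // l; exact: event_time_dwell.
Qed.
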